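(* Let $\frac12<\underline{x}\le1$ and $\rho\in(\varepsilon/2,\underline{x}\varepsilon)$. Let the data-generating distribution $\mathbb{P}_0$ of the scalar random variable $\tilde\xi$ be the two-point distribution with $\mathbb{P}_0[\tilde\xi=1]=\rho$ and $\mathbb{P}_0[\tilde\xi=0]=1-\rho$. Consider the distributionally robust chance constrained program $$(\star)\qquad\min_{\boldsymbol{x}\in\mathbb{R}^3}\; x_3\quad\text{s.t.}\quad \mathbb{P}[x_1>\tilde\xi,\;x_2>\tilde\xi]\ge 1-\varepsilon\;\;\forall\mathbb{P}\in\mathcal{F}(\theta),\quad \underline{x}\le x_1,x_2,x_3\le 1,\;x_3\ge x_1,\;x_3\ge x_2.$$ Then, as $N\to\infty$, with probability going to $1$: (i) the worst-case CVaR approximation of $(\star)$, which replaces the joint chance constraint with $$\sup_{\mathbb{P}\in\mathcal{F}(\theta)}\mathbb{P}\text{-CVaR}_\varepsilon\big(\max\{w_1(\tilde\xi-x_1),\,w_2(\tilde\xi-x_2)\}\big)\le 0,$$ becomes exact if the scaling factors $(w_1,w_2)$ are $(\frac12,\frac12)$; (ii) the Bonferroni approximation of $(\star)$, which replaces the joint chance constraint with $$\mathbb{P}[x_1>\tilde\xi]\ge 1-\varepsilon_1\;\forall\mathbb{P}\in\mathcal{F}(\theta),\qquad \mathbb{P}[x_2>\tilde\xi]\ge 1-\varepsilon_2\;\forall\mathbb{P}\in\mathcal{F}(\theta),$$ becomes infeasible for any choice of risk thresholds $(\varepsilon_1,\varepsilon_2)$.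
   Context: Risk threshold $\varepsilon\in(0,1)$. The samples $\hat\xi_1,\dots,\hat\xi_N\in\mathbb{R}$ are drawn independently from $\mathbb{P}_0$; ''with probability going to $1$'' refers to the sampling. $\hat{\mathbb{P}}=\frac1N\sum_{i=1}^N\delta_{\hat\xi_i}$ is the empirical distribution and $\mathcal{F}(\theta)=\{\mathbb{P}\in\mathcal{P}(\mathbb{R}) : d_{\rm W}(\mathbb{P},\hat{\mathbb{P}})\le\theta\}$, where $\mathcal{P}(\mathbb{R})$ is the set of probability distributions on $\mathbb{R}$ and $d_{\rm W}(\mathbb{P}_1,\mathbb{P}_2)$ is the type-1 Wasserstein distance (infimum of $\mathbb{E}[|\tilde\xi-\tilde\xi'|]$ over all joint distributions with marginals $\mathbb{P}_1,\mathbb{P}_2$). The radius $\theta=\theta_N>0$ satisfies $\theta_N\to0$ as $N\to\infty$, and the probability that $\mathbb{P}_0\in\mathcal{F}(\theta_N)$ tends to one as $N\to\infty$. $\mathbb{P}\text{-CVaR}_\varepsilon(\ell(\tilde\xi))=\inf\{\tau+\mathbb{E}_{\mathbb{P}}[(\ell(\tilde\xi)-\tau)^+]/\varepsilon : \tau\in\mathbb{R}\}$ with $(y)^+=\max\{y,0\}$. Bonferroni risk thresholds are numbers $\varepsilon_1,\varepsilon_2\ge0$ with $\varepsilon_1+\varepsilon_2=\varepsilon$. An approximation is exact if its optimal value equals that of the original problem, and infeasible if no $\boldsymbol{x}$ satisfies all its constraints. *)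

(* Defs.v *)
(* Distributions on the real line are Borel probability measures on R : realType. *)
From HB Require Import structures.
From mathcomp Require Export all_boot all_order all_algebra.
From mathcomp Require Export all_classical all_reals all_analysis.

Set Implicit Arguments.
Unset Strict Implicit.
Unset Printing Implicit Defensive.

Export Order.TTheory GRing.Theory Num.Theory.
Export numFieldNormedType.Exports.

Local Open Scope classical_set_scope.
Local Open Scope ring_scope.

Section sampling.
Context d (Omega : measurableType d) (R : realType) (Pr : probability Omega R).

(* Families indexed by nat; every finite subfamily factorizes. *)
Definition mutually_independent (X : nat -> {RV Pr >-> R}) : Prop :=
  forall (s : seq nat) (B : nat -> set R),
    uniq s -> (forall i, measurable (B i)) ->
    Pr (\bigcap_(i in [set` s]) (X i @^-1` B i)) =
    (\prod_(i <- s) Pr (X i @^-1` B i))%E.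

Definition iid_sample (P0 : probability R R) (X : nat -> {RV Pr >-> R}) : Prop :=
  (forall i (B : set R), measurable B -> distribution Pr (X i) B = P0 B) /\
  mutually_independent X.

(* The probability of the events E_N tends to one.  The events are bounded
   below by measurable ones, so that the notion is meaningful without checking
   that E_N itself is measurable; for measurable E_N it is Pr (E_N) --> 1. *)
Definition with_prob_to_one (E : nat -> set Omega) : Prop :=
  exists A : nat -> set Omega,
    [/\ forall N, measurable (A N),
        forall N, A N `<=` E N &
        Pr (A N) @[N --> \oo] --> 1%E].

End sampling.

Section distributional_uncertainty.
Context {R : realType}.

(* Based on the N points xi 0, ..., xi N.-1; it is the zero measure for N = 0. *)
Definition empirical (N : nat) (xi : nat -> R) : {measure set R -> \bar R} :=
  mscale (N%:R^-1)%:nng (msum (fun i => \d_(xi i)) N).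

Definition coupling (P Q : {measure set R -> \bar R})
    (gamma : probability (R * R)%type R) : Prop :=
  (forall A : set R, measurable A -> gamma (fst @^-1` A) = P A) /\
  (forall A : set R, measurable A -> gamma (snd @^-1` A) = Q A).

Definition wasserstein (P Q : {measure set R -> \bar R}) : \bar R :=
  ereal_inf [set (\int[gamma]_z (`|z.1 - z.2|%:E))%E
            | gamma in coupling P Q].

Definition wball (N : nat) (xi : nat -> R) (theta : R) : set (probability R R) :=
  [set P | (wasserstein P (empirical N xi) <= theta%:E)%E].

Definition CVaR (eps : R) (P : probability R R) (l : R -> R) : \bar R :=
  ereal_inf [set (tau%:E + eps^-1%:E * \int[P]_xi (Num.max (l xi - tau) 0)%:E)%E
            | tau in [set: R]].

End distributional_uncertainty.

Section programs.
Context {R : realType}.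

Definition x1 (x : 'rV[R]_3) : R := x ord0 0.
Definition x2 (x : 'rV[R]_3) : R := x ord0 1.
Definition x3 (x : 'rV[R]_3) : R := x ord0 2.

(* Feasible set of the program with objective x3 whose uncertain constraint is
   C.  The chance constrained program and its approximations share the
   deterministic constraints and differ only in C. *)
Definition program (xlo : R) (C : 'rV[R]_3 -> Prop) : set 'rV[R]_3 :=
  [set x | [/\ C x,
               [/\ xlo <= x1 x <= 1, xlo <= x2 x <= 1 & xlo <= x3 x <= 1],
               x1 x <= x3 x & x2 x <= x3 x]].

Definition infeasible (S : set 'rV[R]_3) : Prop := S = set0.

(* +oo when infeasible. *)
Definition optimal_value (S : set 'rV[R]_3) : \bar R :=
  ereal_inf [set (x3 x)%:E | x in S].

Definition exact_approximation (approx original : set 'rV[R]_3) : Prop :=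
  optimal_value approx = optimal_value original.

Variables (F : set (probability R R)) (eps : R).

Definition joint_chance_constraint (x : 'rV[R]_3) : Prop :=
  forall P, F P ->
    ((1 - eps)%:E <= P [set xi | ((xi < x1 x) /\ (xi < x2 x))%R])%E.

Definition worst_case_CVaR_constraint (w1 w2 : R) (x : 'rV[R]_3) : Prop :=
  (ereal_sup [set CVaR eps P (fun xi => Num.max (w1 * (xi - x1 x))
                                                (w2 * (xi - x2 x)))%R
             | P in F] <= 0)%E.

Definition bonferroni_thresholds (eps1 eps2 : R) : Prop :=
  [/\ 0 <= eps1, 0 <= eps2 & eps1 + eps2 = eps].

Definition bonferroni_constraint (eps1 eps2 : R) (x : 'rV[R]_3) : Prop :=
  (forall P, F P -> ((1 - eps1)%:E <= P [set xi | (xi < x1 x)%R])%E) /\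
  (forall P, F P -> ((1 - eps2)%:E <= P [set xi | (xi < x2 x)%R])%E).

End programs.

(* Main.v *)
Require Import Defs.
From mathcomp Require Import measurable_realfun lra.

Set Implicit Arguments.
Unset Strict Implicit.
Unset Printing Implicit Defensive.

(** All distributions in a Wasserstein ball of radius [theta] have nearly the
    same mean positive part: [y |-> y^+] is 1-Lipschitz, so along a coupling its
    integral moves by at most the transport cost (the easy half of Kantorovich
    duality), and passing through the centre of the ball two members differ by
    at most [2 theta] ([mean_posp_wball]).  On the event that [P0] lies in the
    ball, every [P] in the ball therefore satisfies
    [E_P[xi^+] <= rho + 2 theta].  As [rho < xlo eps] and [theta --> 0], this
    is at most [xlo eps] for all large [N].  The sampling enters only through
    that event, whose probability tends to one.

    The bound [E_P[xi^+] <= xlo eps] makes the vector [(xlo, xlo, xlo)]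
    feasible both for the chance constraint, by Markov's inequality, and for
    the CVaR constraint with weights 1/2, through the choice [tau = - xlo / 2].
    The objective is at least [xlo] on the box, so both programs have the value
    [xlo].

    The Bonferroni approximation already fails at [P0]: one of the thresholds
    is at most [eps / 2 < rho], but since [x1, x2 <= 1] each individual event
    misses the atom at 1 of mass [rho]. *)

Local Open Scope classical_set_scope.
Local Open Scope ring_scope.

(** * Mean positive part over a Wasserstein ball *)

Section positive_part.
Context {R : realType}.
Implicit Types (P Q : {measure set R -> \bar R}).

Definition posp (y : R) : R := Num.max y 0.

Lemma posp_ge0 y : 0 <= posp y.
Proof. by rewrite /posp le_max lexx orbT. Qed.

Lemma posp_lipschitz y z : posp y <= posp z + `|y - z|.
Proof.
rewrite /posp; have := ler_norm (y - z); have := normr_ge0 (y - z).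
by case: (leP y 0); case: (leP z 0); lra.
Qed.

Lemma measurable_posp : measurable_fun [set: R] (fun y => (posp y)%:E).
Proof.
by apply/measurable_EFinP; apply: measurable_maxr => //; exact: measurable_cst.
Qed.

Definition mean_posp (P : {measure set R -> \bar R}) : \bar R :=
  (\int[P]_y (posp y)%:E)%E.

Lemma mean_posp_ge0 P : (0 <= mean_posp P)%E.
Proof. by apply: integral_ge0 => y _; rewrite lee_fin posp_ge0. Qed.

Lemma integral_marginal (P : {measure set R -> \bar R})
    (gamma : probability (R * R)%type R) (h : R * R -> R) :
  measurable_fun setT h ->
  (forall A, measurable A -> gamma (h @^-1` A) = P A) ->
  (\int[gamma]_z (posp (h z))%:E)%E = mean_posp P.
Proof.
move=> mh hP; transitivity (\int[pushforward gamma h]_y (posp y)%:E)%E.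
  rewrite ge0_integral_pushforward//; first exact: measurable_posp.
  by move=> y _; rewrite lee_fin posp_ge0.
by apply: eq_measure_integral => // A mA _; exact: hP.
Qed.

(** Stated for two maps [h] and [k] rather than for the projections, so that
    one coupling can be read in both directions. *)
Lemma mean_posp_le_cost (P Q : {measure set R -> \bar R})
    (gamma : probability (R * R)%type R) (h k : R * R -> R) :
  measurable_fun setT h -> measurable_fun setT k ->
  (forall A, measurable A -> gamma (h @^-1` A) = P A) ->
  (forall A, measurable A -> gamma (k @^-1` A) = Q A) ->
  (mean_posp P <= mean_posp Q + \int[gamma]_z (`|h z - k z|%:E))%E.
Proof.
move=> mh mk hP kQ.
rewrite -(integral_marginal mh hP) -(integral_marginal mk kQ).
have mph : measurable_fun setT (fun z => (posp (h z))%:E).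
  exact: (measurableT_comp measurable_posp mh).
have mpk : measurable_fun setT (fun z => (posp (k z))%:E).
  exact: (measurableT_comp measurable_posp mk).
have mhk : measurable_fun setT (fun z => `|h z - k z|%:E).
  apply/measurable_EFinP; apply: measurableT_comp => //.
  exact: measurable_funB.
rewrite -ge0_integralD//; last by move=> z _; rewrite lee_fin posp_ge0.
apply: ge0_le_integral => //.
- by move=> z _; rewrite lee_fin posp_ge0.
- exact: emeasurable_funD.
- by move=> z _; rewrite -EFinD lee_fin posp_lipschitz.
Qed.

(** An almost optimal coupling gives both bounds; the slack [e] makes up for an
    infimum that need not be attained. *)
Lemma mean_posp_wasserstein P Q (theta : R) :
  (wasserstein P Q <= theta%:E)%E ->
  (mean_posp P <= mean_posp Q + theta%:E)%E /\
  (mean_posp Q <= mean_posp P + theta%:E)%E.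
Proof.
move=> PQ.
have near_optimal (e : R) : 0 < e ->
    (mean_posp P <= mean_posp Q + theta%:E + e%:E)%E /\
    (mean_posp Q <= mean_posp P + theta%:E + e%:E)%E.
  move=> e0.
  have : (wasserstein P Q < theta%:E + e%:E)%E.
    by apply: (le_lt_trans PQ); rewrite -EFinD lte_fin ltrDl.
  move=> /ereal_inf_lt[_ [gamma [gP gQ]] <-] /ltW cost; split.
    (* [leRHS] keeps [addeA] from matching the difference of suprema that
       defines the integral on the left. *)
    apply: (le_trans (mean_posp_le_cost measurable_fst measurable_snd gP gQ)).
    by rewrite -[leRHS]addeA; apply: leeD2l.
  apply: (le_trans (mean_posp_le_cost measurable_snd measurable_fst gQ gP)).
  rewrite -[leRHS]addeA; apply: leeD2l.
  by under eq_integral => z _ do rewrite distrC.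
by split; apply/lee_addgt0Pr => e /near_optimal[].
Qed.

Lemma mean_posp_wball N (xi : nat -> R) (theta : R) (P P' : probability R R) :
  wball N xi theta P -> wball N xi theta P' ->
  (mean_posp P <= mean_posp P' + (2 * theta)%:E)%E.
Proof.
move=> /mean_posp_wasserstein[PQ _] /mean_posp_wasserstein[_ QP'].
apply: (le_trans PQ); rewrite mulr_natl mulr2n EFinD [leRHS]addeA.
exact: leeD2r.
Qed.

Lemma mean_posp_two_point (P : probability R R) (p : R) :
  P [set 1] = p%:E -> P [set 0] = (1 - p)%:E -> mean_posp P = p%:E.
Proof.
move=> P1 P0.
have m01 : measurable ([set 0; 1] : set R).
  by apply: measurableU; exact: measurable_set1.
have P01 : P [set 0; 1] = 1%E.
  rewrite measureU//; last first.
    by apply/seteqP; split => // y [/= -> /eqP]; rewrite eq_sym oner_eq0.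
  transitivity ((1 - p)%:E + p%:E)%E; last by rewrite -EFinD subrK.
  by congr (_ + _)%E.
have P01C : P (~` [set 0; 1]) = 0%E.
  by rewrite probability_setC// P01 subee.
rewrite -P1 -(setIT [set 1]) -integral_indic// /mean_posp.
apply: ae_eq_integral => //.
- exact: measurable_posp.
- by apply/measurable_EFinP; exact: measurable_indic.
exists (~` [set 0; 1]); split.
- exact: measurableC.
- exact: P01C.
- move=> y /= neq [] y01; apply: neq => _; rewrite y01 /posp indicE.
    rewrite maxxx memNset//= => /eqP; by rewrite eq_sym oner_eq0.
  by rewrite mem_set//= max_l.
Qed.

Lemma measurable_ray (a : R) : measurable [set y | a <= y].
Proof.
rewrite (_ : [set _ | _] = `[a, +oo[%classic); first exact: measurable_itv.
by apply/seteqP; split => y; rewrite /= in_itv /= andbT.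
Qed.

Lemma markov_posp (P : probability R R) (a : R) : 0 <= a ->
  (a%:E * P [set y | (a <= y)%R] <= mean_posp P)%E.
Proof.
move=> a0.
have mA := measurable_ray a.
rewrite -integral_cst//.
apply: (@le_trans _ _ (\int[P]_(y in [set y | (a <= y)%R]) (posp y)%:E)%E).
  apply: ge0_le_integral => //.
  - by apply: measurable_funTS; exact: measurable_posp.
  - by move=> y /= ay; rewrite lee_fin /posp le_max ay.
apply: ge0_subset_integral => //.
- exact: measurable_posp.
- by move=> y _; rewrite lee_fin posp_ge0.
Qed.

End positive_part.

(** * The programs *)

Section programs_at_bound.
Context {R : realType} (F : set (probability R R)) (eps xlo : R).
Hypotheses (eps_gt0 : 0 < eps) (xlo_gt0 : 0 < xlo) (xlo_le1 : xlo <= 1).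

Let xbot : 'rV[R]_3 := const_mx xlo.

(** As [xlo <= x3] is itself a constraint, [xbot] is optimal whenever it is
    feasible, whatever the uncertain constraint is. *)
Lemma optimal_value_bottom (C : 'rV[R]_3 -> Prop) :
  C xbot -> optimal_value (program xlo C) = xlo%:E.
Proof.
move=> Cx; apply/eqP; rewrite eq_le; apply/andP; split.
  apply: ereal_inf_lbound; exists xbot; last by rewrite /x3 mxE.
  by split=> //; rewrite /x1 /x2 /x3 !mxE ?lexx.
apply: le_ereal_inf_tmp => _ [x [_ [_ _ /andP[xlo_x3 _]] _ _] <-].
by rewrite lee_fin.
Qed.

Hypothesis mean_le : forall P, F P -> (mean_posp P <= (xlo * eps)%:E)%E.

(** At [xbot] the violation event is [xlo <= xi], to which Markov's inequality
    applies with the positive part as majorant. *)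
Lemma joint_chance_constraint_bottom : joint_chance_constraint F eps xbot.
Proof.
move=> P /mean_le mP.
have -> : [set xi | xi < x1 xbot /\ xi < x2 xbot] = ~` [set xi | xlo <= xi].
  apply/seteqP; split => y; rewrite /x1 /x2 !mxE /=.
    by move=> [yx _]; apply/negP; rewrite -ltNge.
  by move=> /negP; rewrite -ltNge.
have mA := measurable_ray xlo.
rewrite probability_setC// EFinB leeB//.
have := le_trans (markov_posp P (ltW xlo_gt0)) mP.
by rewrite EFinM lee_pmul2l.
Qed.

(** With [tau = - xlo / 2] the positive part of the loss in excess of [tau]
    is exactly half that of [xi], so the CVaR objective at this [tau] is
    [- xlo / 2 + E_P[xi^+] / (2 eps)]. *)
Lemma worst_case_CVaR_constraint_bottom :
  worst_case_CVaR_constraint F eps (1 / 2) (1 / 2) xbot.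
Proof.
apply: ge_ereal_sup => _ [P /mean_le mP <-].
apply: ge_ereal_inf; exists ((- (xlo / 2))%:E + eps^-1%:E *
    \int[P]_y (2^-1%:E * (posp y)%:E))%E.
  exists (- (xlo / 2)) => //; congr (_ + _ * _)%E.
  apply: eq_integral => y _; rewrite -EFinM /x1 /x2 !mxE maxxx; congr (_%:E).
  by rewrite /posp maxr_pMr ?invr_ge0// mulr0; congr (Num.max _ 0); lra.
rewrite ge0_integralZl_EFin//; first last.
- exact: measurable_posp.
- by move=> y _; rewrite lee_fin posp_ge0.
have := mean_posp_ge0 P; move: mP; rewrite -/(mean_posp P).
case: (mean_posp P) => // m; rewrite !lee_fin => mP _.
have : eps^-1 * m <= xlo by rewrite mulrC ler_pdivrMr.
by rewrite mulrCA; lra.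
Qed.

End programs_at_bound.

Section bonferroni.
Context {R : realType}.

(** The event [xi < t] excludes the atom at [a >= t], so its probability is at
    most [1 - p]. *)
Lemma atom_le_threshold (P : probability R R) (a p e t : R) :
  P [set a] = p%:E -> t <= a ->
  ((1 - e)%:E <= P [set xi | (xi < t)%R])%E -> p <= e.
Proof.
move=> Pa ta eP; rewrite -(lerD2l (1 - e - p)).
suff : 1 - e <= 1 - p by lra.
rewrite -lee_fin (le_trans eP)// EFinB -Pa -probability_setC//.
apply: le_measure; rewrite ?inE//.
- rewrite (_ : [set _ | _] = `]-oo, t[%classic); first exact: measurable_itv.
  by apply/seteqP; split => y; rewrite /= in_itv.
- exact: measurableC.
by move=> y /= yt ya; move: yt; rewrite ya ltNge ta.
Qed.

Lemma bonferroni_infeasible (F : set (probability R R)) (eps xlo p : R)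
    (P : probability R R) (eps1 eps2 : R) :
  F P -> P [set 1] = p%:E -> eps / 2 < p ->
  bonferroni_thresholds eps eps1 eps2 ->
  infeasible (program xlo (bonferroni_constraint F eps1 eps2)).
Proof.
move=> FP P1 p_gt [_ _ sum_eps]; apply/seteqP; split => // x.
move=> [[C1 C2] [/andP[_ x1_le1] /andP[_ x2_le1] _] _ _].
have := atom_le_threshold P1 x1_le1 (C1 P FP).
have := atom_le_threshold P1 x2_le1 (C2 P FP).
by lra.
Qed.

End bonferroni.

(** * Large samples *)

Lemma with_prob_to_one_eventually (R : realType) (d : measure_display)
    (Omega : measurableType d) (Pr : probability Omega R)
    (E E' : nat -> set Omega) :
  (\forall N \near \oo, E N `<=` E' N) ->
  with_prob_to_one Pr E -> with_prob_to_one Pr E'.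
Proof.
move=> [N0 _ subE] [A [mA AE cvgA]].
(* The inclusion in [E' N] is required for every [N], and [set0] provides it
   below [N0] without changing the limit. *)
exists (fun N => if (N0 <= N)%N then A N else set0); split.
- by move=> N; case: ifP.
- move=> N; case: ifP => [N0N|_]; last exact: sub0set.
  exact: subset_trans (AE N) (subE N N0N).
apply: cvg_trans cvgA; apply: near_eq_cvg.
by exists N0 => // N /= ->.
Qed.

Theorem proposition14 (R : realType) (d : measure_display)
    (Omega : measurableType d) (Pr : probability Omega R)
    (eps xlo rho : R) (P0 : probability R R)
    (xihat : nat -> {RV Pr >-> R}) (theta : nat -> R)
    (heps : 0 < eps < 1)
    (hxlo : 1 / 2 < xlo <= 1)
    (hrho : eps / 2 < rho < xlo * eps)
    (hP0_1 : P0 [set 1] = rho%:E)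
    (hP0_0 : P0 [set 0] = (1 - rho)%:E)
    (hsample : iid_sample P0 xihat)
    (htheta_gt0 : forall N, 0 < theta N)
    (htheta_cvg : theta N @[N --> \oo] --> 0)
    (hball : with_prob_to_one Pr (fun N => [set omega |
       wball N (fun i => xihat i omega) (theta N) P0])) :
  with_prob_to_one Pr (fun N => [set omega |
    let F := wball N (fun i => xihat i omega) (theta N) in
    exact_approximation
      (program xlo (worst_case_CVaR_constraint F eps (1 / 2) (1 / 2)))
      (program xlo (joint_chance_constraint F eps)) /\
    (forall eps1 eps2 : R, bonferroni_thresholds eps eps1 eps2 ->
      infeasible (program xlo (bonferroni_constraint F eps1 eps2)))]).
Proof.
move: heps hxlo hrho => /andP[eps0 _] /andP[xlo_half xlo1] /andP[rho_lo rho_hi].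
have xlo0 : 0 < xlo by lra.
apply: with_prob_to_one_eventually hball.
have slack_gt0 : 0 < (xlo * eps - rho) / 2 by lra.
move/cvgr0_norm_lt : htheta_cvg => /(_ _ slack_gt0).
apply: filterS => N theta_lt omega /= P0_in; split; last first.
  by move=> eps1 eps2; exact: bonferroni_infeasible P0_in hP0_1 rho_lo.
have mean_le P : wball N (fun i => xihat i omega) (theta N) P ->
    (mean_posp P <= (xlo * eps)%:E)%E.
  move=> P_in; apply: (le_trans (mean_posp_wball P_in P0_in)).
  rewrite (mean_posp_two_point hP0_1 hP0_0) -EFinD lee_fin.
  by have := ler_norm (theta N); lra.
rewrite /exact_approximation !optimal_value_bottom//.
- exact: joint_chance_constraint_bottom.
- exact: worst_case_CVaR_constraint_bottom.
Qed.
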